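(* Let $\langle \ell, p\rangle$ be a problem with agent set $N=\{1,\dots,n\}$, let $x^*\in X$ be the efficient profile, i.e. $\mathbb{C}(x^* )\le \mathbb{C}(x)$ for all $x\in X$, and let $\phi^*$ be the solution defined from $x^*$ by \[ \phi^*(i,i)=\ell_i+\sum_{k>i}\Big(\prod_{i<j\le k}p_j(x^*_j)\Big)\ell_k \quad (i\in N),\qquad \phi^*(i,j)=(1-p_j(x^*_j))\,\phi^*(j,j)\quad (i<j), \] and $\phi^*(i,j)=0$ for $j<i$. Then a solution $\phi$ satisfies \[ \frac{\partial C_k(x^*;\phi)}{\partial x_i}=0\quad\text{for all } i,k\in N \text{ with } i\le k \] if and only if $\phi=\phi^*$.
   Context: Agents: $N=\{1,\dots,n\}$, ordered. A problem $\langle \ell,p\rangle$ consists of losses $\ell=(\ell_1,\dots,\ell_n)\in\mathbb{R}^n_{>0}$ and technologies $p=(p_i)_{i\in N}$, where each $p_i:\mathbb{R}_{\ge 0}\to[0,1]$ is strictly increasing, strictly concave, continuous on $[0,\infty)$ and differentiable on $(0,\infty)$, with $p_i(0)=0$ and $p_i'(x_i)\to\infty$ as $x_i\to 0$. A profile is $x=(x_i)_{i\in N}\in X=\mathbb{R}^n_{\ge 0}$. A solution is a function $\phi:N\times N\to\mathbb{R}_{\ge 0}$ with $\phi(i,j)=0$ for all $j<i$ and (balance) $\sum_{j\ge i}\phi(i,j)=\sum_{j\ge i}\ell_j$ for all $i\in N$. Given $\phi$, the expected cost of agent $k$ at profile $x$ is \[ C_k(x;\phi)=\sum_{j<k}\Big(\prod_{i<j}p_i(x_i)\Big)(1-p_j(x_j))\,\phi(j,k)+\Big(\prod_{i<k}p_i(x_i)\Big)(1-p_k(x_k))\,\phi(k,k)+x_k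 \] (empty sums are $0$, empty products are $1$). The total cost is $\mathbb{C}(x)=\sum_{j\in N}\big(1-\prod_{i\le j}p_i(x_i)\big)\ell_j+\sum_{j\in N}x_j$. *)

(* Defs.v *)
From HB Require Import structures.
From mathcomp Require Export all_boot all_order all_algebra.
From mathcomp Require Export all_classical all_reals all_analysis.

Set Implicit Arguments.
Unset Strict Implicit.
Unset Printing Implicit Defensive.

Import Order.TTheory GRing.Theory Num.Theory.
Import numFieldNormedType.Exports.

Local Open Scope classical_set_scope.
Local Open Scope ring_scope.

(* A technology is a map from the nonnegative reals to [0, 1]. It is encoded by
   a total function on R; every requirement below concerns only its values at
   nonnegative arguments. *)
Record technology (R : realType) (f : R -> R) : Prop := Technology {
  technology_itv : forall x : R, 0 <= x -> 0 <= f x <= 1;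
  technology_incr : forall x y : R, 0 <= x -> x < y -> f x < f y;
  technology_concave : forall x y t : R, 0 <= x -> 0 <= y -> x != y ->
    0 < t < 1 -> t * f x + (1 - t) * f y < f (t * x + (1 - t) * y);
  technology_continuous : {within `[0, +oo[, continuous f};
  technology_derivable : forall x : R, 0 < x -> derivable f x 1;
  technology0 : f 0 = 0;
  technology_inada : derive1 f x @[x --> (0 : R)^'+] --> +oo
}.

(* The n agents are the elements of 'I_n, in their natural order. *)
Record problem (R : realType) (n : nat)
    (l : 'I_n -> R) (p : 'I_n -> R -> R) : Prop := Problem {
  loss_gt0 : forall i, 0 < l i;
  problem_technology : forall i, technology (p i)
}.

Definition profile (R : realType) (n : nat) (x : 'I_n -> R) : Prop :=
  forall i, 0 <= x i.

Record solution (R : realType) (n : nat)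
    (l : 'I_n -> R) (phi : 'I_n -> 'I_n -> R) : Prop := Solution {
  solution_ge0 : forall i j, 0 <= phi i j;
  solution_lower0 : forall i j : 'I_n, (j < i)%N -> phi i j = 0;
  solution_balance : forall i : 'I_n,
    \sum_(j < n | (i <= j)%N) phi i j = \sum_(j < n | (i <= j)%N) l j
}.

Definition agent_cost (R : realType) (n : nat) (p : 'I_n -> R -> R)
    (phi : 'I_n -> 'I_n -> R) (k : 'I_n) (x : 'I_n -> R) : R :=
  \sum_(j < n | (j < k)%N)
     (\prod_(i < n | (i < j)%N) p i (x i)) * (1 - p j (x j)) * phi j k
  + (\prod_(i < n | (i < k)%N) p i (x i)) * (1 - p k (x k)) * phi k k
  + x k.

Definition total_cost (R : realType) (n : nat)
    (l : 'I_n -> R) (p : 'I_n -> R -> R) (x : 'I_n -> R) : R :=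
  \sum_(j < n) (1 - \prod_(i < n | (i <= j)%N) p i (x i)) * l j
  + \sum_(j < n) x j.

Definition efficient (R : realType) (n : nat)
    (l : 'I_n -> R) (p : 'I_n -> R -> R) (x : 'I_n -> R) : Prop :=
  profile x /\ forall y, profile y -> total_cost l p x <= total_cost l p y.

Definition phi_star_diag (R : realType) (n : nat)
    (l : 'I_n -> R) (p : 'I_n -> R -> R) (x : 'I_n -> R) (i : 'I_n) : R :=
  l i + \sum_(k < n | (i < k)%N)
          (\prod_(j < n | (i < j <= k)%N) p j (x j)) * l k.

Definition phi_star (R : realType) (n : nat)
    (l : 'I_n -> R) (p : 'I_n -> R -> R) (x : 'I_n -> R) (i j : 'I_n) : R :=
  if i == j then phi_star_diag l p x i
  else if (i < j)%N then (1 - p j (x j)) * phi_star_diag l p x j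
  else 0.

(* The partial derivative of F with respect to its i-th coordinate exists at x
   and equals d. The derivative of the i-th slice is two-sided; at an efficient
   profile this only involves nonnegative arguments near x i, since
   technology_inada forces every coordinate to be positive there. *)
Definition is_partial (R : realType) (n : nat)
    (F : ('I_n -> R) -> R) (x : 'I_n -> R) (i : 'I_n) (d : R) : Prop :=
  is_derive (x i) (1 : R) (fun t : R => F [eta x with i |-> t]) d.

(* Main.v *)
(** Moving the [i]-th coordinate alone changes [total_cost] by
    [(t - x i) - P * D * (p i t - p i (x i))], where [P] is the product of the
    [p m (x m)] for [m < i] and [D = phi_star_diag l p x i > 0].  Since [p i] is
    infinitely steep at 0, an efficient profile therefore has positive
    coordinates, and the first-order condition reads [P * D * (p i)' = 1]; in
    particular [P * (p i)' <> 0].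

    For [i <= k] the slice of [agent_cost p phi k] has the same form, with [D]
    replaced by [cost_slope p phi x i k] and [t - x i] present only if [i = k].
    The criterion thus prescribes [cost_slope], a unitriangular linear operator
    applied to the column [phi _ k], which has exactly one solution.  That
    [phi_star] is this solution and is balanced comes down to two telescoping
    sums. *)
Require Import Defs.
From mathcomp Require Import all_boot all_order all_algebra ring lra.
From mathcomp Require Import all_classical all_reals all_analysis.

Set Implicit Arguments.
Unset Strict Implicit.
Unset Printing Implicit Defensive.

Import Order.TTheory GRing.Theory Num.Theory.
Import numFieldNormedType.Exports.

Local Open Scope ring_scope.

(** * Products over intervals of agents and their telescoping sums *)

Section Telescoping.
Variables (R : comNzRingType) (n : nat) (q : 'I_n -> R).

Lemma big_ord_between_recr (T : Type) (idx : T) (op : Monoid.com_law idx)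
    (F : 'I_n -> T) (i : nat) (k : 'I_n) : (i < k)%N ->
  \big[op/idx]_(m < n | (i < m < k.+1)%N) F m =
  op (F k) (\big[op/idx]_(m < n | (i < m < k)%N) F m).
Proof.
move=> ik; rewrite (bigD1 k) /=; last by rewrite ik ltnSn.
congr (op _ _); apply: eq_bigl => m; rewrite ltnS -andbA; congr (_ && _).
by rewrite ltn_neqAle andbC -val_eqE.
Qed.

Lemma big_ord_between_nil (T : Type) (idx : T) (op : Monoid.law idx)
    (F : 'I_n -> T) (i k : nat) : (k <= i.+1)%N ->
  \big[op/idx]_(m < n | (i < m < k)%N) F m = idx.
Proof.
move=> ki; rewrite big_pred0// => m; apply/negP => /andP[im mk].
by move: (leq_trans mk ki); rewrite ltnS leqNgt im.
Qed.

(** Each summand is the product over [i < m < j] minus the product over [i < m <= j]. *)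
Lemma sum_prefix_prod_telescope (i k : nat) : (k <= n)%N ->
  \sum_(j < n | (i < j < k)%N) (\prod_(m < n | (i < m < j)%N) q m) * (1 - q j)
  = 1 - \prod_(m < n | (i < m < k)%N) q m.
Proof.
elim: k => [|k IH] kn; first by rewrite !big_ord_between_nil// subrr.
have [ki|ik] := leqP k i; first by rewrite !big_ord_between_nil// subrr.
rewrite !(@big_ord_between_recr _ _ _ _ _ (Ordinal kn))//= IH ?(ltnW kn)//.
by ring.
Qed.

(** Raising [k] by one multiplies every old summand by [q k] and adds [1 - q k], whose product is
    empty; so the induction factors [q k] out. *)
Lemma sum_suffix_prod_telescope (i k : nat) : (k <= n)%N ->
  \sum_(j < n | (i < j < k)%N) (\prod_(m < n | (j < m < k)%N) q m) * (1 - q j)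
  = 1 - \prod_(m < n | (i < m < k)%N) q m.
Proof.
elim: k => [|k IH] kn; first by rewrite !big_ord_between_nil// subrr.
have [ki|ik] := leqP k i; first by rewrite !big_ord_between_nil// subrr.
rewrite [LHS](@big_ord_between_recr _ _ _ _ _ (Ordinal kn))//=.
rewrite [in RHS](@big_ord_between_recr _ _ _ _ _ (Ordinal kn))//=.
rewrite big_ord_between_nil// mul1r.
under eq_bigr => j /andP[_ jk].
  rewrite (@big_ord_between_recr _ _ _ _ _ (Ordinal kn))//= -mulrA.
  over.
by rewrite -mulr_sumr IH ?(ltnW kn)//; ring.
Qed.

Lemma prod_ord_split (i : 'I_n) (k : nat) : (i < k)%N ->
  \prod_(m < n | (m < k)%N && (m != i)) q m =
  (\prod_(m < n | (m < i)%N) q m) * \prod_(m < n | (i < m < k)%N) q m.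
Proof.
move=> ik; rewrite (bigID (fun m : 'I_n => (m < i)%N)) /=; congr (_ * _).
  apply: eq_bigl => m.
  case: (ltngtP m i) => [mi|//|/val_inj ->]; rewrite ?andbF//.
  by rewrite (ltn_trans mi ik) -val_eqE /= ltn_eqF.
apply: eq_bigl => m; rewrite -leqNgt -val_eqE /=.
by case: (ltngtP i m) => _; rewrite ?andbF ?andbT.
Qed.
End Telescoping.

(** * Bounds, derivative and steepness at 0 of a technology *)

Section Technology.
Variables (R : realType) (f : R -> R) (hf : technology f).

Lemma technology_ge0 (x : R) : 0 <= x -> 0 <= f x.
Proof. by move=> /(technology_itv hf) /andP[]. Qed.

Lemma technology_gt0 (x : R) : 0 < x -> 0 < f x.
Proof. by move=> x0; rewrite -(technology0 hf) (technology_incr hf). Qed.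

Lemma technology_le1 (x : R) : 0 <= x -> f x <= 1.
Proof. by move=> /(technology_itv hf) /andP[]. Qed.

Lemma technology_is_derive (x : R) : 0 < x -> is_derive x 1 f (derive1 f x).
Proof.
move=> x0; apply: DeriveDef; last by rewrite derive1E.
exact: technology_derivable hf _ x0.
Qed.

(** Near 0 the derivative exceeds [c]; the mean value theorem from 0, where [f] vanishes, turns this
    into a bound on [f t]. *)
Lemma technology_steep (c : R) : exists2 t, 0 < t & c * t < f t.
Proof.
have /cvgryPgt/(_ c)[/= e e0 He] := technology_inada hf.
have t0 : 0 < e / 2 by rewrite divr_gt0.
exists (e / 2) => //.
have [||s] := @MVT R f (derive1 f) 0 (e / 2) t0.
- by move=> x; rewrite in_itv/= => /andP[x0 _]; exact: technology_is_derive.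
- apply: continuous_subspaceW (technology_continuous hf) => x /=.
  by rewrite !in_itv/= andbT => /andP[].
rewrite in_itv/= => /andP[s0 st]; rewrite (technology0 hf) !subr0 => ->.
rewrite ltr_pM2r//; apply: He => //=.
by rewrite sub0r normrN gtr0_norm//; lra.
Qed.
End Technology.

(** * Costs along one coordinate, and the linear system for [phi] *)

Section Slices.
Variables (R : realType) (n : nat).
Implicit Types (l : 'I_n -> R) (p : 'I_n -> R -> R) (x : 'I_n -> R).

Definition prefix_prod p x (i : nat) : R := \prod_(m < n | (m < i)%N) p m (x m).

Definition between_prod p x (i k : nat) : R :=
  \prod_(m < n | (i < m < k)%N) p m (x m).

Lemma prefix_prod_slice p x (i : 'I_n) (k : nat) (t : R) :
  prefix_prod p [eta x with i |-> t] k =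
  prefix_prod p x k + (i < k)%:R *
    (prefix_prod p x i * between_prod p x i k * (p i t - p i (x i))).
Proof.
rewrite /prefix_prod /between_prod.
have [ik|ki] := ltnP i k; last first.
  rewrite mul0r addr0; apply: eq_bigr => m mk /=.
  by rewrite -val_eqE /= ltn_eqF// (leq_trans mk).
rewrite mul1r (bigD1 i)//= eqxx [in RHS](bigD1 i)//=.
under eq_bigr => m /andP[_ /negPf im] do rewrite /= im.
by rewrite (prod_ord_split (fun m => p m (x m)))//; ring.
Qed.

Lemma sum_slice x (i : 'I_n) (t : R) :
  \sum_(j < n) [eta x with i |-> t] j = \sum_(j < n) x j + (t - x i).
Proof.
rewrite (bigD1 i)//= eqxx [in RHS](bigD1 i)//=.
under eq_bigr => m /negPf im do rewrite /= im.
by ring.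
Qed.

Lemma phi_star_diagE l p x (i : 'I_n) :
  phi_star_diag l p x i =
  \sum_(j < n | (i <= j)%N) between_prod p x i j.+1 * l j.
Proof.
rewrite (bigD1 i)//= /between_prod big_ord_between_nil// mul1r; congr (_ + _).
by apply: eq_bigl => j; rewrite andbC -val_eqE eq_sym -ltn_neqAle.
Qed.

Lemma total_cost_slice l p x (i : 'I_n) (t : R) :
  total_cost l p [eta x with i |-> t] =
  total_cost l p x
  - prefix_prod p x i * phi_star_diag l p x i * (p i t - p i (x i))
  + (t - x i).
Proof.
rewrite /total_cost sum_slice addrA; congr (_ + _).
rewrite [RHS]addrAC; congr (_ + _).
rewrite phi_star_diagE [X in _ - _ * X * _]big_mkcond/=.
rewrite mulr_sumr mulr_suml -sumrB.
apply: eq_bigr => j _.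
rewrite -[\prod_(_ < n | _) _]/(prefix_prod p [eta x with i |-> t] j.+1).
rewrite -[\prod_(_ < n | _) _]/(prefix_prod p x j.+1) prefix_prod_slice ltnS.
by case: leqP => _; rewrite ?mulr1n ?mulr0n; ring.
Qed.

(** Given success of all agents before [i], this is what agent [k] saves per unit of [p i]: the
    payment [phi i k] is avoided, but the expected payments for failures after [i] are incurred. *)
Definition cost_slope p (phi : 'I_n -> 'I_n -> R) x (i k : 'I_n) : R :=
  phi i k - \sum_(j < n | (i < j < k.+1)%N)
              between_prod p x i j * (1 - p j (x j)) * phi j k.

Lemma agent_costE p phi (k : 'I_n) x :
  agent_cost p phi k x =
  \sum_(j < n | (j <= k)%N) prefix_prod p x j * (1 - p j (x j)) * phi j k + x k.
Proof.
rewrite /agent_cost [in RHS](bigD1 k)//= [in RHS]addrC addrC; congr (_ + _).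
rewrite addrC; congr (_ + _); apply: eq_bigl => j.
by rewrite ltn_neqAle andbC -val_eqE.
Qed.

Lemma agent_cost_slice p phi x (i k : 'I_n) (t : R) : (i <= k)%N ->
  agent_cost p phi k [eta x with i |-> t] =
  agent_cost p phi k x
  - prefix_prod p x i * cost_slope p phi x i k * (p i t - p i (x i))
  + (i == k)%:R * (t - x i).
Proof.
move=> ik; rewrite !agent_costE /= [X in _ = X + _]addrAC -[RHS]addrA.
congr (_ + _); last first.
  by rewrite eq_sym; case: eqVneq => [->|_]; rewrite ?mulr1n ?mulr0n; ring.
(* The summand [j = i] changes only through [1 - p i t], the summands [j > i] only through their
   prefix product. *)
rewrite /cost_slope [X in _ = X - _](bigD1 i)//= [LHS](bigD1 i)//= eqxx.
rewrite prefix_prod_slice ltnn mul0r addr0.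
set B := \sum_(j < n | (i < j < k.+1)%N) _.
set S := \sum_(j < n | _) prefix_prod p x j * _ * _.
suff -> : \sum_(j < n | (j <= k)%N && (j != i))
    prefix_prod p [eta x with i |-> t] j *
    (1 - p j (if j == i then t else x j)) * phi j k
  = S + prefix_prod p x i * B * (p i t - p i (x i)) by ring.
rewrite /S /B mulr_sumr mulr_suml.
(* Indicators put both sums on the same index set, so that they can be compared termwise. *)
have -> (F : 'I_n -> R) : \sum_(j < n | (i < j < k.+1)%N) F j =
    \sum_(j < n | (j <= k)%N && (j != i)) (i < j)%:R * F j.
  rewrite [RHS](bigID (fun j : 'I_n => (i < j)%N)) /= [X in _ + X]big1 ?addr0.
    apply: eq_big => [j|j /andP[-> _]]; last by rewrite mul1r.
    by rewrite ltnS -val_eqE /=; case: (ltngtP i j); rewrite ?andbF ?andbT.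
  by move=> j /andP[_ /negPf ->]; rewrite mul0r.
rewrite -big_split /=; apply: eq_bigr => j /andP[_ /negPf ->].
by rewrite prefix_prod_slice; ring.
Qed.

(** Back substitution up column [k]: [phi i k] is its slope plus a combination of the entries
    [phi j k] with [i < j <= k]. *)
Lemma cost_slope_inj p x (phi psi : 'I_n -> 'I_n -> R) :
  (forall i k : 'I_n, (i <= k)%N ->
     cost_slope p phi x i k = cost_slope p psi x i k) ->
  forall i k : 'I_n, (i <= k)%N -> phi i k = psi i k.
Proof.
move=> eq_slope i k; have [N] := ubnP (k - i)%N; elim: N i => // N IH i ltN ik.
have := eq_slope i k ik; rewrite /cost_slope.
rewrite (eq_bigr (fun j : 'I_n =>
  between_prod p x i j * (1 - p j (x j)) * psi j k)); first by move/addIr.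
move=> j /andP[ij]; rewrite ltnS => jk; rewrite IH//.
rewrite ltnS in ltN; apply: leq_trans ltN.
exact: ltn_sub2l (leq_trans ij jk) ij.
Qed.

(** Above the diagonal, column [k] of [phi_star] is constant, equal to [1 - p k (x k)] times its
    diagonal entry. For [i < k] the telescoping sum and the diagonal term therefore add up to
    exactly that constant. *)
Lemma cost_slope_phi_star l p x (i k : 'I_n) : (i <= k)%N ->
  cost_slope p (phi_star l p x) x i k = (i == k)%:R * phi_star_diag l p x i.
Proof.
rewrite leq_eqVlt => /predU1P[/val_inj <-|ik].
  by rewrite /cost_slope big_ord_between_nil// subr0 /phi_star eqxx mul1r.
rewrite /cost_slope big_ord_between_recr// /= -val_eqE ltn_eqF// mul0r.
rewrite /phi_star eqxx ik -val_eqE ltn_eqF//=.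
rewrite (eq_bigr (fun j : 'I_n => between_prod p x i j * (1 - p j (x j)) *
  ((1 - p k (x k)) * phi_star_diag l p x k))).
  rewrite -mulr_suml /between_prod.
  rewrite (sum_prefix_prod_telescope (fun m => p m (x m)))//; last exact: ltnW.
  by ring.
by move=> j /andP[_ jk]; rewrite -val_eqE ltn_eqF//= jk.
Qed.

Lemma phi_star_balance l p x (i : 'I_n) :
  \sum_(j < n | (i <= j)%N) phi_star l p x i j = \sum_(j < n | (i <= j)%N) l j.
Proof.
have geE (F : 'I_n -> R) : \sum_(j < n | (i <= j)%N) F j =
    F i + \sum_(j < n | (i < j)%N) F j.
  rewrite (bigD1 i)//=; congr (_ + _).
  by apply: eq_bigl => j; rewrite andbC -val_eqE eq_sym -ltn_neqAle.
rewrite !geE {1}/phi_star eqxx /phi_star_diag -addrA; congr (_ + _).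
rewrite [X in _ + X](eq_bigr (fun j : 'I_n => \sum_(k < n | (j <= k)%N)
   between_prod p x j k.+1 * (1 - p j (x j)) * l k)); last first.
  move=> j ij; rewrite /phi_star -val_eqE ltn_eqF//= ij.
  by rewrite phi_star_diagE mulr_sumr; apply: eq_bigr => k _; ring.
(* After the exchange, [l k] has coefficient [Q] from the diagonal entry and [1 - Q] from the
   others, with [Q] the product over [i < m <= k]. *)
rewrite (exchange_big_dep (fun k : 'I_n => (i < k)%N))/=; last first.
  by move=> j k; exact: leq_trans.
rewrite -big_split/=; apply: eq_bigr => k ik.
rewrite -mulr_suml /between_prod.
rewrite [X in _ + X * _](sum_suffix_prod_telescope (fun m => p m (x m)) i
  (ltn_ord k)).
rewrite (eq_bigl (fun m : 'I_n => (i < m < k.+1)%N))//; ring.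
Qed.
End Slices.

(** * First-order conditions at an efficient profile *)

Section Efficiency.
Variables (R : realType) (n : nat) (l : 'I_n -> R) (p : 'I_n -> R -> R).
Hypothesis hP : problem l p.
Variable x : 'I_n -> R.

Let hp i : technology (p i) := problem_technology hP i.

Lemma phi_star_diag_gt0 (i : 'I_n) : profile x -> 0 < phi_star_diag l p x i.
Proof.
move=> x0; rewrite ltr_wpDr ?(loss_gt0 hP)//; apply: sumr_ge0 => k _.
rewrite mulr_ge0 ?(ltW (loss_gt0 hP k))//; apply: prodr_ge0 => j _.
exact: technology_ge0 (hp j) _ (x0 j).
Qed.

Lemma phi_star_solution : profile x -> solution l (phi_star l p x).
Proof.
move=> x0; split=> [i j|i j ji|i]; last exact: phi_star_balance.
  rewrite /phi_star; case: eqP => _; first exact/ltW/phi_star_diag_gt0.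
  case: ifP => // _; rewrite mulr_ge0 ?(ltW (phi_star_diag_gt0 j x0))//.
  by rewrite subr_ge0 (technology_le1 (hp j)).
by rewrite /phi_star -val_eqE gtn_eqF//= ltnNge ltnW.
Qed.

Hypothesis hx : efficient l p x.

Lemma efficient_slice_le (i : 'I_n) (t : R) : 0 <= t ->
  prefix_prod p x i * phi_star_diag l p x i * (p i t - p i (x i)) <= t - x i.
Proof.
move=> t0; have [x0 xmin] := hx.
have /xmin : profile [eta x with i |-> t] by move=> j /=; case: eqP.
by rewrite total_cost_slice; lra.
Qed.

(** Strong induction along the order of agents: investing at [i] pays only if the prefix product is
    positive, which needs the earlier coordinates to be positive. *)
Lemma efficient_gt0 (i : 'I_n) : 0 < x i.
Proof.
have [N] := ubnP (i : nat); elim: N i => // N IH i; rewrite ltnS => iN.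
have [x0 _] := hx; rewrite lt0r x0 andbT; apply/eqP => xi0.
have c0 : 0 < prefix_prod p x i * phi_star_diag l p x i.
  rewrite mulr_gt0 ?phi_star_diag_gt0//; apply: prodr_gt0 => m mi.
  by apply: (technology_gt0 (hp m)); apply: IH; exact: leq_trans mi iN.
(* With this slope, moving from 0 to [t] saves more than its cost [t]. *)
have [t t0] := technology_steep (hp i)
  (prefix_prod p x i * phi_star_diag l p x i)^-1.
have := efficient_slice_le i (ltW t0).
rewrite xi0 (technology0 (hp i)) !subr0 -ler_pdivlMl// => h1 h2.
by have := lt_le_trans h2 h1; rewrite ltxx.
Qed.

Lemma is_derive_affine_technology (i : 'I_n) (a b c : R) :
  is_derive (x i) (1 : R)
    (fun t => a - b * (p i t - p i (x i)) + c * (t - x i))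
    (c - b * derive1 (p i) (x i)).
Proof.
have dp := technology_is_derive (hp i) (efficient_gt0 i).
apply: is_derive_eq.
rewrite /GRing.scale /=; ring.
Qed.

Lemma efficient_foc (i : 'I_n) :
  prefix_prod p x i * phi_star_diag l p x i * derive1 (p i) (x i) = 1.
Proof.
set b := prefix_prod p x i * phi_star_diag l p x i.
(* [F] is the change in total cost, written in the shape of [is_derive_affine_technology]. Its
   derivative at the interior minimum [x i] is computed in two ways. *)
pose F t := 0 - b * (p i t - p i (x i)) + 1 * (t - x i).
have xi0 := efficient_gt0 i.
have dF : is_derive (x i) (1 : R) F 0.
  apply: (@derive1_at_min R F 0 (x i + 1));
    rewrite ?in_itv/= ?xi0 ?ltrDl ?ltr01//.
  - by rewrite addr_ge0// ltW.
  - move=> t; rewrite in_itv/= => /andP[t0 _].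
    have dp := technology_is_derive (hp i) t0.
    exact: ex_derive.
  - move=> t; rewrite in_itv/= => /andP[/ltW/(efficient_slice_le i) + _].
    by rewrite /F -/b !subrr !mulr0; lra.
have dF' : is_derive (x i) (1 : R) F (1 - b * derive1 (p i) (x i)).
  exact: is_derive_affine_technology.
have := @derive_val _ _ _ _ _ _ _ dF.
by rewrite (@derive_val _ _ _ _ _ _ _ dF'); lra.
Qed.

Lemma is_partial_agent_costP (phi : 'I_n -> 'I_n -> R) (i k : 'I_n) :
  (i <= k)%N ->
  is_partial (agent_cost p phi k) x i 0 <->
  cost_slope p phi x i k = cost_slope p (phi_star l p x) x i k.
Proof.
move=> ik; have foc := efficient_foc i.
set u := prefix_prod p x i * derive1 (p i) (x i).
have u0 : u != 0.
  apply/eqP => uE; have := foc; rewrite mulrAC -/u uE mul0r => /esym/eqP.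
  by rewrite oner_eq0.
have -> : cost_slope p phi x i k = cost_slope p (phi_star l p x) x i k <->
    (i == k)%:R - u * cost_slope p phi x i k = 0.
  rewrite cost_slope_phi_star//.
  (* The first-order condition exhibits the own-cost term as a multiple of [u], which then
     cancels. *)
  have key : (i == k)%:R = u * ((i == k)%:R * phi_star_diag l p x i).
    by rewrite -[LHS]mulr1 -foc /u; ring.
  by rewrite {2}key; split=> [->|/subr0_eq/(mulfI u0)/esym//]; rewrite subrr.
have -> : (i == k)%:R - u * cost_slope p phi x i k = (i == k)%:R -
  prefix_prod p x i * cost_slope p phi x i k * derive1 (p i) (x i).
  by rewrite /u; ring.
rewrite /is_partial.
under eq_fun do rewrite agent_cost_slice//.
have dF := is_derive_affine_technology i (agent_cost p phi k x)
  (prefix_prod p x i * cost_slope p phi x i k) (i == k)%:R.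
split=> [d0|<- //].
by rewrite -(@derive_val _ _ _ _ _ _ _ dF) (@derive_val _ _ _ _ _ _ _ d0).
Qed.
End Efficiency.

Theorem theorem2 (R : realType) (n : nat)
    (l : 'I_n -> R) (p : 'I_n -> R -> R) (xstar : 'I_n -> R)
    (hP : problem l p) (hx : efficient l p xstar) :
  solution l (phi_star l p xstar) /\
  forall phi : 'I_n -> 'I_n -> R, solution l phi ->
    ((forall i k : 'I_n, (i <= k)%N ->
        is_partial (agent_cost p phi k) xstar i 0)
     <-> phi = phi_star l p xstar).
Proof.
have sol := phi_star_solution hP (proj1 hx); split=> // phi phi_sol.
split=> [crit|-> i k ik]; last exact/(is_partial_agent_costP hP hx).
(* The criterion is silent below the diagonal, where every solution vanishes. *)
apply/funext => i; apply/funext => k; have [ik|ki] := leqP i k; last first.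
  by rewrite (solution_lower0 phi_sol)// (solution_lower0 sol).
apply: (cost_slope_inj (p := p) (x := xstar)) ik => i' k' ik'.
exact/(is_partial_agent_costP hP hx)/crit.
Qed.
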